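(* Let $(S,\preceq,\lambda)$ be a standard poset, let $X$ be a random variable with values in $S$ (with support $S$ and upper probability function $F$ with values in $(0,1]$), and let $\alpha>0$. Then $X$ has constant rate $\alpha$ if and only if $$\mathbb{E}[Lg(X)]=\frac{1}{\alpha}\,\mathbb{E}[g(X)]$$ for every $g\in\mathcal{D}(S)$ (for which the expectations are meaningful, i.e. either $g\ge 0$, with both sides understood in $[0,\infty]$, or $\mathbb{E}|g(X)|<\infty$ and $\mathbb{E}[L|g|(X)]<\infty$).
   Context: For a poset $(S,\preceq)$ let $I[x]=\{t\in S: t\succeq x\}$ and $D[x]=\{t\in S: t\preceq x\}$. A standard poset $(S,\preceq,\lambda)$ is a poset with a topology and a Borel measure such that: $S$ is locally compact, locally convex (every point has a neighborhood base of convex sets, where $A$ is convex if $a,b\in A$, $a\preceq x\preceq b$ imply $x\in A$) and has a countable base; $\{(x,y)\in S^2: x\preceq y\}$ is closed in $S^2$; $D[x]$ is compact for each $x\in S$; $\lambda$ is a positive Borel measure, finite on compact sets, with $\lambda(V)>0$ for every nonempty open $V$. Probability density functions (PDFs) are with respect to $\lambda$. Random variables $X$ in $S$ are assumed to have a Borel distribution with support $S$; the upper probability function (UPF) of $X$ is $F(x)=\mathbb{P}(X\succeq x)$, assumed to take values in $(0,1]$. $X$ has constant rate $\alpha>0$ if $\alpha F$ is a PDF of $X$. $\mathcal{D}(S)$ is the set of measurable $g:S\to\mathbb{R}$ that are bounded on $D[x]$ for each $x\in S$, and the lower operator $L$ is $Lg(x)=\int_{D[x]}g(t)\,d\lambda(t)$.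 *)

(* Defs.v *)
From HB Require Import structures.
From mathcomp Require Import all_boot all_order all_algebra.
From mathcomp Require Import all_classical all_reals all_analysis.

Set Implicit Arguments.
Unset Strict Implicit.
Unset Printing Implicit Defensive.

Import Order.TTheory GRing.Theory Num.Theory.

Local Open Scope classical_set_scope.
Local Open Scope ring_scope.

Notation borel S := (g_sigma_algebraType (@open S)).

Section order_sets.
Context {d : Order.disp_t} {S : porderType d}.

Definition upper_cone (x : S) : set S := [set t | (x <= t)%O].

Definition lower_cone (x : S) : set S := [set t | (t <= x)%O].

Definition order_convex (A : set S) : Prop :=
  forall a b x : S, A a -> A b -> (a <= x)%O -> (x <= b)%O -> A x.

End order_sets.

Definition locally_order_convex {d : Order.disp_t}
    (S : POrderedTopological.type d) : Prop :=
  forall (x : S) (U : set S), nbhs x U ->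
    exists V : set S, [/\ nbhs x V, order_convex V & V `<=` U].

(* The point carried by S only makes S nonempty, which the library requires of
   a measurable space; it is not used.  The Hausdorff property is not listed: it
   follows from sp_closed_order and antisymmetry. *)
Record standard_poset {R : realType} {d : Order.disp_t}
    {S : POrderedPointedTopological.type d}
    (lambda : {measure set (borel S) -> \bar R}) : Prop := {
  sp_locally_compact : locally_compact [set: S];
  sp_locally_convex : locally_order_convex S;
  sp_countable_base : @second_countable S;
  sp_closed_order : closed [set xy : S * S | (xy.1 <= xy.2)%O];
  sp_compact_lower : forall x : S, compact (lower_cone x);
  sp_finite_compact :
    forall K : set S, compact K -> (lambda K < +oo)%E;
  sp_positive_open :
    forall V : set S, open V -> V !=set0 -> (0 < lambda V)%E
}.

Definition measure_support {R : realType} {S : ptopologicalType}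
    (mu : {measure set (borel S) -> \bar R}) : set S :=
  [set x | forall V : set S, open V -> V x -> (0 < mu V)%E].

Section random_variable.
Context {R : realType} {d : Order.disp_t} {S : POrderedPointedTopological.type d}.
Context {dO : measure_display} {Omega : measurableType dO}.
Variables (lambda : {measure set (borel S) -> \bar R}) (P : probability Omega R).

Definition upf (X : {RV P >-> borel S}) (x : S) : R :=
  fine (distribution P X (upper_cone x)).

Definition is_pdf (X : {RV P >-> borel S}) (f : S -> R) : Prop :=
  [/\ measurable_fun [set: borel S] f,
      forall x : S, 0 <= f x &
      forall A : set (borel S), measurable A ->
        distribution P X A = (\int[lambda]_(x in A) (f x)%:E)%E].

Definition constant_rate (X : {RV P >-> borel S}) (alpha : R) : Prop :=
  is_pdf X (fun x => alpha * upf X x).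

End random_variable.

Section lower_operator.
Context {R : realType} {d : Order.disp_t} {S : POrderedPointedTopological.type d}.

Definition lower_bounded_functions : set (S -> R) :=
  [set g : S -> R | measurable_fun [set: borel S] g /\
     forall x : S, exists M : R, forall t : S, lower_cone x t -> `|g t| <= M].

Definition lower_operator (lambda : {measure set (borel S) -> \bar R})
    (g : S -> R) (x : S) : R :=
  \int[lambda]_(t in lower_cone x) g t.

End lower_operator.
Arguments lower_bounded_functions {R d} S.

(* Main.v *)
Require Import Defs.
From mathcomp Require Import all_boot all_order all_algebra.
From mathcomp Require Import all_classical all_reals all_analysis.
From mathcomp Require Import measurable_realfun.

Import Order.TTheory GRing.Theory Num.Theory.

Local Open Scope classical_set_scope.
Local Open Scope ring_scope.
Local Open Scope ereal_scope.

(** Write mu for the distribution of X, D[x] and I[x] for the lower and upper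
cones of x, and F for the upper probability function, so that F x = mu I[x].
Everything rests on one application of Tonelli's theorem to the graph
{(t, x) | t <= x}, whose section at a fixed x is D[x] and at a fixed t is I[t]: for g >= 0,

    E[Lg(X)] = int mu(dx) int_D[x] g dlambda = int g(t) F(t) lambda(dt)

([ge0_expectation_lower_operator]).  If alpha F is a density of X, the right
side is E[g(X)] / alpha ([constant_rate_ge0]), and a signed g with E|g(X)|
finite is treated by splitting it into its positive and negative parts
([constant_rate_integrable]).  Conversely, taking for g the indicator of a Borel
set A turns the identity into P(X in A) = alpha int_A F dlambda, which says that
alpha F is a density of X ([constant_rate_indic]).

Tonelli's theorem requires the graph to belong to the product of the two Borel
sigma-algebras and lambda to be sigma-finite.  Both come from the countable
base: an open set of the square is a countable union of open rectangles
([open_measurable_prod]), and by local compactness the basic open sets of finite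
measure cover S ([borel_sigma_finite]). *)

(** * Borel sets and measures on second countable spaces *)

Lemma borel_open {T : ptopologicalType} (U : set T) :
  open U -> measurable (U : set (borel T)).
Proof. exact: sub_sigma_algebra. Qed.

Lemma borel_closed {T : ptopologicalType} (C : set T) :
  closed C -> measurable (C : set (borel T)).
Proof.
by move=> /closed_openC /borel_open mC; rewrite -[C]setCK; exact: measurableC.
Qed.

Lemma countable_enum {I : choiceType} (D : set I) : countable D -> D !=set0 ->
  exists2 e : nat -> I, (forall n, D (e n)) & (forall i, D i -> exists n, e n = i).
Proof.
move=> /pfcard_geP[->[]//|[f] _]; exists f => [n|i Di]; first exact: funS.
by have [n _ <-] := @surj _ _ _ _ f i Di; exists n.
Qed.

Lemma countable_bigcup_measurable d (T : measurableType d) (I : choiceType)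
    (D : set I) (F : I -> set T) :
  countable D -> (forall i, D i -> measurable (F i)) ->
  measurable (\bigcup_(i in D) F i).
Proof.
move=> cD mF; have [->|/set0P D0] := eqVneq D set0; first by rewrite bigcup_set0.
have [e De eD] := countable_enum _ cD D0.
rewrite (_ : \bigcup_(i in D) F i = \bigcup_n F (e n)).
  by apply: bigcupT_measurable => n; exact/mF/De.
apply/seteqP; split=> t; first by move=> [i /eD[n <-] Fi]; exists n.
by move=> [n _ Fn]; exists (e n).
Qed.

(** Without a countable base the Borel sigma-algebra of the product can be
strictly larger than the product of the Borel sigma-algebras.  Here the
rectangles of basic open sets that lie inside A already exhaust A, and there are
countably many of them. *)
Lemma open_measurable_prod (S T : ptopologicalType) (A : set (S * T)) :
  @second_countable S -> @second_countable T -> open A ->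
  measurable (A : set (borel S * borel T)).
Proof.
move=> [B cB [oB bB]] [C cC [oC bC]] oA.
rewrite (_ : A = \bigcup_(U in B) \bigcup_(V in [set V | C V /\ U `*` V `<=` A])
  (U `*` V)).
  apply: countable_bigcup_measurable => // U BU.
  apply: countable_bigcup_measurable.
    by apply: (sub_countable _ cC); apply: subset_card_le => V [].
  move=> V [CV _]; apply: measurableX.
    exact: (borel_open _ (oB _ BU)).
  exact: (borel_open _ (oC _ CV)).
apply/seteqP; split=> [[x y] Axy|_ [U _ [V [_ UVA] /UVA]]//].
have [[U V] /= [/bB[U' [BU' U'x] U'U] /bC[V' [CV' V'y] V'V]] UVA] :
  nbhs (x, y) A by apply: open_nbhs_nbhs.
exists U' => //; exists V' => //; split=> // -[a b] [/U'U Ua /V'V Vb].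
exact: UVA.
Qed.

(** Every point has a compact neighborhood, hence a basic open neighborhood
inside it, which has finite measure; the base being countable, these sets can be
enumerated. *)
Lemma borel_sigma_finite {R : realType} (S : ptopologicalType)
    (mu : {measure set (borel S) -> \bar R}) :
  locally_compact [set: S] -> @second_countable S ->
  (forall K : set S, compact K -> mu K < +oo) ->
  sigma_finite [set: borel S] mu.
Proof.
move=> lS [B cB [oB bB]] muK.
pose D := [set U | B U /\ mu U < +oo].
have DE x : exists2 U, D U & U x.
  have [K + [cK clK]] := lS x I; rewrite withinET => xK.
  have [U [BU Ux] UK] := bB x _ xK.
  exists U => //; split=> //.
  apply: le_lt_trans (muK _ cK); apply: le_measure.
  - by rewrite inE; exact: (borel_open _ (oB _ BU)).
  - by rewrite inE; exact: borel_closed.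
  - exact: UK.
have cD : countable D.
  by apply: (sub_countable _ cB); apply: subset_card_le => U [].
have D0 : D !=set0 by have [U DU _] := DE point; exists U.
have [e De eD] := countable_enum _ cD D0.
exists e; first by apply/seteqP; split=> // x _; have [_ /eD[n <-] ?] := DE x; exists n.
by move=> n; have [Ben ?] := De n; split=> //; exact: (borel_open _ (oB _ Ben)).
Qed.

(** * Integration against a density, and Tonelli on sections *)

Section density.
Context d (T : measurableType d) (R : realType).
Variables (mu : {sigma_finite_measure set T -> \bar R}).
Variables (nu : {finite_measure set T -> \bar R}).

(** A density f of nu is almost everywhere equal to the Radon-Nikodym derivative
of nu, for which the change of variables formula is known. *)
Lemma ge0_integral_density (f : T -> R) (g : T -> \bar R) :
  measurable_fun [set: T] f -> (forall x, (0 <= f x)%R) ->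
  (forall A, measurable A -> nu A = \int[mu]_(x in A) (f x)%:E) ->
  measurable_fun [set: T] g -> (forall x, 0 <= g x) ->
  \int[nu]_x g x = \int[mu]_x (g x * (f x)%:E).
Proof.
move=> mf f0 nuE mg g0.
have mfE : measurable_fun [set: T] (EFin \o f) by exact/measurable_EFinP.
have numu : nu `<< mu.
  apply/null_content_dominatesP => A mA muA0.
  by rewrite nuE// null_set_integral//; exact: measurable_funTS.
have mRN := measurable_int _ (Radon_Nikodym_SigmaFinite.f_integrable numu).
rewrite -(Radon_Nikodym_SigmaFinite.change_of_variables numu)//.
apply: ae_eq_integral => //.
- exact: emeasurable_funM.
- exact: emeasurable_funM.
apply: ae_eqe_mul2l.
apply: integral_ae_eq => //; first exact: Radon_Nikodym_SigmaFinite.f_integrable.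
move=> E _ mE.
by rewrite -Radon_Nikodym_SigmaFinite.f_integral// nuE.
Qed.

End density.

Section tonelli_sections.
Context d1 d2 (T1 : measurableType d1) (T2 : measurableType d2) (R : realType).
Variables (m1 : {sigma_finite_measure set T1 -> \bar R}).
Variables (m2 : {sigma_finite_measure set T2 -> \bar R}).
Variables (A : set (T1 * T2)) (g : T1 -> \bar R).
Hypotheses (mA : measurable A) (mg : measurable_fun [set: T1] g).
Hypothesis g0 : forall x, 0 <= g x.

(* Integrating g over the section of A at y is integrating x |-> h (x, y) over
   the whole space, which puts both iterated integrals in the form required by
   Tonelli's theorem. *)
Let h (z : T1 * T2) : \bar R := g z.1 * (\1_A z)%:E.

Let mh : measurable_fun [set: T1 * T2] h.
Proof.
apply: emeasurable_funM; first exact: (measurableT_comp mg).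
exact/measurable_EFinP/measurable_indic.
Qed.

Let h0 z : 0 <= h z.
Proof. by rewrite mule_ge0// lee_fin. Qed.

Let hE y : \int[m1]_(x in ysection A y) g x = \int[m1]_x h (x, y).
Proof.
rewrite integral_mkcond epatch_indic; apply: eq_integral => x _ /=.
by rewrite /h /= !indicE mem_ysection.
Qed.

Lemma measurable_integral_ysection :
  measurable_fun [set: T2] (fun y => \int[m1]_(x in ysection A y) g x).
Proof.
under eq_fun do rewrite hE.
exact: (measurable_fun_fubini_tonelli_G _ mh h0).
Qed.

Lemma integral_ysection_xsection :
  \int[m2]_y \int[m1]_(x in ysection A y) g x =
  \int[m1]_x (g x * m2 (xsection A x)).
Proof.
under eq_integral do rewrite hE.
rewrite -(fubini_tonelli h mh h0); apply: eq_integral => x _.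
have mAx : measurable (xsection A x) by exact: measurable_xsection.
rewrite -[xsection A x]setIT -integral_indic// -ge0_integralZl//=.
  by apply: eq_integral => y _; rewrite /h /= !indicE mem_xsection.
exact/measurable_EFinP/measurable_indic.
Qed.

End tonelli_sections.

(** Turns the proposition that mu is sigma-finite into the structure over which
Tonelli's theorem is stated, so that mu can be replaced by the structured nu. *)
Lemma sigma_finite_measure_ex d (T : measurableType d) (R : realType)
    (mu : {measure set T -> \bar R}) : sigma_finite [set: T] mu ->
  exists nu : {sigma_finite_measure set T -> \bar R}, mu = nu.
Proof.
case: mu => f [content_f measure_f] fsigma.
have sfin_f := isSFinite.Build _ _ _ f (sfinite_measure_sigma_finite fsigma).
have sigma_f := isSigmaFinite.Build _ _ _ f fsigma.
by exists (SigmaFiniteMeasure.Pack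
  (SigmaFiniteMeasure.Class measure_f sfin_f sigma_f)).
Qed.

(** * The lower operator of a standard poset *)

Lemma indic_lower_bounded (R : realType) (d : Order.disp_t)
    (S : POrderedPointedTopological.type d) (A : set (borel S)) :
  measurable A -> lower_bounded_functions S (\1_A : S -> R).
Proof.
move=> mA; split; first by apply/measurable_indicP.
by move=> x; exists 1%R => t _; rewrite indicE ger0_norm// lern1 leq_b1.
Qed.

Section standard_poset_theory.
Context {R : realType} {d : Order.disp_t} {S : POrderedPointedTopological.type d}.
Variable lambda : {sigma_finite_measure set (borel S) -> \bar R}.
Hypothesis hS : standard_poset lambda.

Let order_graph : set (borel S * borel S) := [set xy | (xy.1 <= xy.2 :> S)%O].

Let lower_coneE (x : S) : lower_cone x = ysection order_graph x.
Proof. by apply/seteqP; split => t /=; rewrite /ysection/= inE. Qed.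

Let upper_coneE (x : S) : upper_cone x = xsection order_graph x.
Proof. by apply/seteqP; split => t /=; rewrite /xsection/= inE. Qed.

Let measurable_order_graph : measurable order_graph.
Proof.
rewrite -[order_graph]setCK; apply: measurableC.
apply: open_measurable_prod; [exact: sp_countable_base hS..|].
exact/closed_openC/(sp_closed_order hS).
Qed.

Lemma measurable_lower_cone (x : S) : measurable (lower_cone x : set (borel S)).
Proof. by rewrite lower_coneE; exact: measurable_ysection. Qed.

Lemma measurable_upper_cone (x : S) : measurable (upper_cone x : set (borel S)).
Proof. by rewrite upper_coneE; exact: measurable_xsection. Qed.

Lemma measurable_upper_measure (mu : probability (borel S) R) :
  measurable_fun [set: borel S] (fun x => mu (upper_cone x)).
Proof.
under eq_fun do rewrite upper_coneE.
exact: (measurable_fun_xsection mu measurable_order_graph).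
Qed.

(** Compactness of D[x] gives it finite measure, and g is bounded on it. *)
Lemma integrable_lower_cone (g : S -> R) (x : S) :
  lower_bounded_functions S g -> lambda.-integrable (lower_cone x) (EFin \o g).
Proof.
move=> [mg bg]; apply: measurable_bounded_integrable.
- exact: measurable_lower_cone.
- exact/(sp_finite_compact hS)/(sp_compact_lower hS).
- exact: measurable_funTS.
have [M gM] := bg x; exists M; split; first exact: num_real.
by move=> y My t /gM /le_trans; apply; exact: ltW.
Qed.

(** The lower operator is a real-valued integral, for which infinite values
collapse to 0; finiteness on the cones shows that nothing is lost, so that
extended-real integration theory applies. *)
Lemma EFin_lower_operator (g : S -> R) (x : S) : lower_bounded_functions S g ->
  (lower_operator lambda g x)%:E = \int[lambda]_(t in lower_cone x) (g t)%:E.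
Proof.
move=> Dg; rewrite fineK//; apply: integrable_fin_num.
  exact: measurable_lower_cone.
exact: integrable_lower_cone.
Qed.

Lemma measurable_lower_operator (g : S -> R) : lower_bounded_functions S g ->
  (forall x, (0 <= g x)%R) ->
  measurable_fun [set: borel S] (lower_operator lambda g).
Proof.
move=> Dg g0; apply/measurable_EFinP.
rewrite (_ : _ \o _ =
    fun x => \int[lambda]_(t in ysection order_graph x) (g t)%:E).
  apply: measurable_integral_ysection => //.
  by apply/measurable_EFinP; exact: Dg.1.
by apply/funext => x; rewrite /= EFin_lower_operator// lower_coneE.
Qed.

Lemma integral_lower_operator (mu : probability (borel S) R) (g : S -> R) :
  lower_bounded_functions S g -> (forall x, (0 <= g x)%R) ->
  \int[mu]_x (lower_operator lambda g x)%:E =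
  \int[lambda]_t ((g t)%:E * mu (upper_cone t)).
Proof.
move=> Dg g0; under eq_integral do rewrite EFin_lower_operator// lower_coneE.
rewrite (integral_ysection_xsection _ _ _ _ _ lambda mu)//.
  by apply: eq_integral => t _; rewrite upper_coneE.
by apply/measurable_EFinP; exact: Dg.1.
Qed.

(** * Constant rate *)

Context {dO : measure_display} {Omega : measurableType dO}.
Variables (P : probability Omega R) (X : {RV P >-> borel S}).
Let mu := distribution P X.

Lemma EFin_upf (x : S) : (upf X x)%:E = mu (upper_cone x).
Proof.
by rewrite fineK//; apply: fin_num_measure; exact: measurable_upper_cone.
Qed.

Lemma ge0_expectation_distribution (g : S -> R) :
  measurable_fun [set: borel S] g -> (forall x, (0 <= g x)%R) ->
  'E_P[fun w => g (X w)] = \int[mu]_x (g x)%:E.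
Proof.
by move=> mg g0; rewrite unlock ge0_integral_distribution//; exact/measurable_EFinP.
Qed.

(** The two iterated integrals of g over the order graph: E[Lg(X)] integrates
over D[X] and then over X, while fixing t first leaves the mu-measure of I[t]
as the weight of g t. *)
Lemma ge0_expectation_lower_operator (g : S -> R) :
  lower_bounded_functions S g -> (forall x, (0 <= g x)%R) ->
  'E_P[fun w => lower_operator lambda g (X w)] =
  \int[lambda]_t ((g t)%:E * (upf X t)%:E).
Proof.
move=> Dg g0; rewrite ge0_expectation_distribution//.
- rewrite integral_lower_operator//.
  by apply: eq_integral => t _; rewrite EFin_upf.
- exact: measurable_lower_operator.
- by move=> x; apply: Rintegral_ge0.
Qed.

Lemma constant_rate_ge0 (alpha : R) (g : S -> R) : (0 < alpha)%R ->
  constant_rate lambda X alpha ->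
  lower_bounded_functions S g -> (forall x, (0 <= g x)%R) ->
  'E_P[fun w => lower_operator lambda g (X w)] =
  (1 / alpha)%:E * 'E_P[fun w => g (X w)].
Proof.
move=> alpha0 [mpdf pdf0 pdfE] Dg g0; have [mg _] := Dg.
rewrite ge0_expectation_lower_operator// ge0_expectation_distribution//.
have mupf : measurable_fun [set: borel S] (fun t => (upf X t)%:E).
  under eq_fun do rewrite EFin_upf.
  exact: measurable_upper_measure.
have mgE : measurable_fun [set: borel S] (EFin \o g) by exact/measurable_EFinP.
rewrite (ge0_integral_density _ _ _ lambda mu _ _ mpdf pdf0 pdfE)//.
under [in RHS]eq_integral do rewrite EFinM muleCA.
rewrite ge0_integralZl//; last 3 first.
- exact: emeasurable_funM.
- by move=> x _; rewrite -EFinM lee_fin mulr_ge0// fine_ge0.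
- by rewrite lee_fin ltW.
by rewrite muleA -EFinM mul1r mulVf ?gt_eqF// mul1e.
Qed.

(** The identity for the positive and negative parts of g, which also makes
their images under L integrable, gives the signed case by subtraction. *)
Lemma constant_rate_integrable (alpha : R) (g : S -> R) : (0 < alpha)%R ->
  constant_rate lambda X alpha ->
  lower_bounded_functions S g -> 'E_P[fun w => `|g (X w)|%R] < +oo ->
  'E_P[fun w => lower_operator lambda g (X w)] =
  (1 / alpha)%:E * 'E_P[fun w => g (X w)].
Proof.
move=> alpha0 rateX Dg gfin; have [mg bg] := Dg.
have Dpart (h : S -> R) : measurable_fun [set: borel S] h ->
    (forall x, `|h x| <= `|g x|)%R -> lower_bounded_functions S h.
  move=> mh hg; split=> // x; have [M gM] := bg x.
  by exists M => t /gM; exact: le_trans.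
have Dp : lower_bounded_functions S (g^\+)%R.
  apply: Dpart; first exact: measurable_funrpos.
  move=> x; rewrite ger0_norm// -[leRHS]/((Num.norm \o g) x) -funrposDneg.
  by rewrite lerDl.
have Dn : lower_bounded_functions S (g^\-)%R.
  apply: Dpart; first exact: measurable_funrneg.
  move=> x; rewrite ger0_norm// -[leRHS]/((Num.norm \o g) x) -funrposDneg.
  by rewrite lerDr.
have intg : P.-integrable [set: Omega] (EFin \o (g \o X)).
  apply/integrableP; split.
    by apply/measurable_EFinP; exact: measurableT_comp.
  by move: gfin; rewrite unlock.
have Lfunp : (fun w => g^\+ (X w))%R \in Lfun P 1.
  by apply/Lfun1_integrable; exact: (integrable_funrpos _ intg).
have Lfunn : (fun w => g^\- (X w))%R \in Lfun P 1.
  by apply/Lfun1_integrable; exact: (integrable_funrneg _ intg).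
have LfunL (h : S -> R) : lower_bounded_functions S h ->
    (forall x, (0 <= h x)%R) -> (fun w => h (X w)) \in Lfun P 1 ->
    (fun w => lower_operator lambda h (X w)) \in Lfun P 1.
  move=> Dh h0 Lfunh; apply/Lfun1_integrable/integrableP; split.
    apply/measurable_EFinP; apply: (measurableT_comp _ (measurable_funPT X)).
    exact: measurable_lower_operator.
  under eq_integral do rewrite /= ger0_norm ?Rintegral_ge0//.
  have := constant_rate_ge0 _ _ alpha0 rateX Dh h0.
  rewrite [in LHS]unlock => ->.
  by rewrite lte_mul_pinfty ?lee_fin ?divr_ge0 ?ltW// ltey_eq expectation_fin_num.
have -> : (fun w => lower_operator lambda g (X w)) =
    ((fun w => lower_operator lambda g^\+ (X w)) \-
     (fun w => lower_operator lambda g^\- (X w)))%R.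
  apply/funext => w /=; rewrite -RintegralB.
  - by apply: eq_Rintegral => t _; rewrite -[in LHS](funrposBneg g).
  - exact: measurable_lower_cone.
  - exact: integrable_lower_cone.
  - exact: integrable_lower_cone.
have -> : (fun w => g (X w)) =
    ((fun w => g^\+ (X w)) \- (fun w => g^\- (X w)))%R.
  by apply/funext => w /=; rewrite -[in LHS](funrposBneg g).
rewrite !expectationB//; [|exact: LfunL..].
rewrite !(constant_rate_ge0 alpha)// muleBr// fin_num_adde_defl// fin_numN.
exact: expectation_fin_num.
Qed.

(** For the indicator of A the two sides are int_A F dlambda and
P(X in A) / alpha: indicators of Borel sets are enough to recover the density. *)
Lemma constant_rate_indic (alpha : R) : (0 < alpha)%R ->
  (forall A : set (borel S), measurable A ->
    'E_P[fun w => lower_operator lambda \1_A (X w)] =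
    (1 / alpha)%:E * 'E_P[fun w => \1_A (X w)]) ->
  constant_rate lambda X alpha.
Proof.
move=> alpha0 LE.
have upf0 x : (0 <= upf X x)%R by exact: fine_ge0.
have mupf : measurable_fun [set: borel S] (EFin \o upf X).
  rewrite (_ : _ \o _ = fun x => mu (upper_cone x)).
    exact: measurable_upper_measure.
  by apply/funext => x; exact: EFin_upf.
split=> [|x|A mA].
- by apply: measurable_funM => //; exact/measurable_EFinP.
- by rewrite mulr_ge0// ltW.
have DA := indic_lower_bounded R _ _ _ mA.
have := LE A mA.
rewrite ge0_expectation_lower_operator// (ge0_expectation_distribution _ DA.1)//.
rewrite integral_indic// setIT => /(congr1 (fun y => alpha%:E * y)).
rewrite muleA -EFinM mulrA mulr1 mulfV ?gt_eqF// mul1e => <-.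
under [RHS]eq_integral do rewrite EFinM.
rewrite ge0_integralZl//; last 3 first.
- exact: (measurable_funTS mupf).
- by move=> x _; rewrite lee_fin.
- by rewrite lee_fin ltW.
congr (_ * _); rewrite [RHS]integral_mkcond epatch_indic.
by apply: eq_integral => x _; rewrite muleC.
Qed.

End standard_poset_theory.

Theorem proposition6 (R : realType) (d : Order.disp_t)
  (S : POrderedPointedTopological.type d)
  (lambda : {measure set (borel S) -> \bar R})
  (hS : standard_poset lambda)
  (dO : measure_display) (Omega : measurableType dO)
  (P : probability Omega R) (X : {RV P >-> borel S})
  (hsupp : measure_support (distribution P X) = [set: S])
  (hF : forall x : S, (0 < upf X x <= 1)%R)
  (alpha : R) (halpha : (0 < alpha)%R) :
  constant_rate lambda X alpha <->
  (forall g : S -> R, lower_bounded_functions S g ->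
     (forall x : S, (0 <= g x)%R) \/
     ('E_P[fun w => `|g (X w)|%R] < +oo /\
      'E_P[fun w => lower_operator lambda (fun t => `|g t|%R) (X w)] < +oo) ->
     'E_P[fun w => lower_operator lambda g (X w)] =
       (1 / alpha)%R%:E * 'E_P[fun w => g (X w)]).
Proof.
have [nu lambdaE] : exists nu : {sigma_finite_measure set (borel S) -> \bar R},
    lambda = nu.
  apply/sigma_finite_measure_ex/borel_sigma_finite.
  - exact: sp_locally_compact hS.
  - exact: sp_countable_base hS.
  - exact: sp_finite_compact hS.
subst lambda; split=> [rateX g Dg [g0|[gfin _]]|LE].
- exact: constant_rate_ge0.
- exact: constant_rate_integrable.
apply: constant_rate_indic => // A mA; apply: LE; last by left.
exact: indic_lower_bounded.
Qed.
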